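(* Let $k,n,p\ge1$, let $\mathcal{A}\in\mathbb{C}^{n\times\dots\times n\times p}$ be an order $2k+1$ $t$-Hermitian positive semidefinite hypermatrix, let $c\in\mathbb{T}_p^+$, and define, for each $\ell\in[p]$, $$\alpha_\ell:=\min_{\|z\|=1}h_{\widehat{\mathcal{A}}_{(\ell)}}(z),$$ the minimum being over $z\in\mathbb{C}^n$ with $\|z\|=1$. Then $$h_{\Phi_c(\mathcal{A})}(z)\ge\gamma_c(\mathcal{A})\|z\|^{2k}\qquad\text{for all }z\in\mathbb{C}^n,$$ where $$\gamma_c(\mathcal{A}):=\frac1p\sum_{\ell=1}^p\widehat c[\ell]\,\alpha_\ell,$$ hence $h_{\Phi_c(\mathcal{A})}$ is Hermitian positive semidefinite. Furthermore, if additionally $\mathcal{A}$ is $t$-Hermitian positive definite and $c\ne0$, then $\gamma_c(\mathcal{A})>0$, hence $h_{\Phi_c(\mathcal{A})}$ is Hermitian positive definite.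
   Context: Notation: $[m]=\{1,\dots,m\}$; a hypermatrix of order $N$ is an element of $\mathbb{C}^{n_1\times\dots\times n_N}$; $\|z\|$ is the Euclidean norm. For a tube $a\in\mathbb{C}^p$, $\widehat a=\mathrm{fft}(a)$ is the unnormalized discrete Fourier transform $\widehat a[\ell]=\sum_{m=1}^p e^{-2\pi i(\ell-1)(m-1)/p}a[m]$. For a hypermatrix whose last mode (the tubal mode) has length $p$, the hat denotes applying $\mathrm{fft}$ along that mode, and the subscript $(\ell)$ denotes the $\ell$-th frontal slice, i.e. the last index fixed equal to $\ell$. Conjugate partial symmetry: an order $2k$ hypermatrix $\mathcal{B}=[b_{i_1\dots i_kj_1\dots j_k}]\in\mathbb{C}^{n\times\dots\times n}$ is conjugate partially symmetric if $\overline{b_{j_{\sigma(1)}\dots j_{\sigma(k)}i_{\tau(1)}\dots i_{\tau(k)}}}=b_{i_1\dots i_kj_1\dots j_k}$ for all indices and all $\sigma,\tau\in S_k$. An order $2k+1$ hypermatrix $\mathcal{A}\in\mathbb{C}^{n\times\dots\times n\times p}$ is $t$-conjugate partially symmetric if every $\widehat{\mathcal{A}}_{(\ell)}$, $\ell\in[p]$, is conjugate partially symmetric. Classical forms: for an order $2k$ hypermatrix $\mathcal{B}\in\mathbb{C}^{n\times\dots\times n}$, $h_{\mathcal{B}}(z)=\sum b_{i_1\dots i_kj_1\dots j_k}\overline{z_{i_1}}\cdots\overline{z_{i_k}}z_{j_1}\cdots z_{j_k}$ for $z\in\mathbb{C}^n$ (real-valued when $\mathcal{B}$ is conjugate partially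 symmetric); $h_{\mathcal{B}}$ is Hermitian positive definite (semidefinite) if $h_{\mathcal{B}}(z)>0$ ($\ge0$) for all nonzero $z\in\mathbb{C}^n$. $t$-Hermitian forms: $\mathbb{T}_p=\mathbb{C}^{1\times1\times p}\cong\mathbb{C}^p$ is the algebra of tubes with product the circular convolution $(a\circledast b)[\ell]=\sum_{m=1}^p a[m]\,b[((\ell-m)\bmod p)+1]$, and $\mathbb{T}_p^n\cong\mathbb{C}^{n\times1\times p}$. Fourier conjugation $J$ acts on tubes by $J(a)[\ell+1]=\overline{a[((-\ell)\bmod p)+1]}$, $\ell=0,\dots,p-1$. For a $t$-conjugate partially symmetric $\mathcal{A}$ and $\mathcal{Z}\in\mathbb{T}_p^n$ with tubes $\mathcal{Z}[i,:]$, $h_{\mathcal{A}}(\mathcal{Z})=\sum \mathcal{A}[i_1,\dots,i_k,j_1,\dots,j_k,:]\circledast J(\mathcal{Z}[i_1,:])\circledast\cdots\circledast J(\mathcal{Z}[i_k,:])\circledast\mathcal{Z}[j_1,:]\circledast\cdots\circledast\mathcal{Z}[j_k,:]\in\mathbb{T}_p$, summing over all indices in $[n]$. $t$-positivity: $\mathbb{T}_p^+=\{a\in\mathbb{T}_p:\widehat a[\ell]\ge0\text{ for all }\ell\in[p]\}$. An order $2k+1$ hypermatrix $\mathcal{A}$ is $t$-Hermitian positive definite (semidefinite) if it is $t$-conjugate partially symmetric and $h_{\mathcal{A}}(\mathcal{Z})\in\mathbb{T}_p^+\setminus\{0\}$ ($\in\mathbb{T}_p^+$) for all nonzero $\mathcal{Z}\in\mathbb{T}_p^n$.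 Contraction: for $c\in\mathbb{T}_p$, the $c$-contraction hypermatrix of an order $2k+1$ hypermatrix $\mathcal{A}$ is the order $2k$ hypermatrix $\Phi_c(\mathcal{A})=\sum_{\ell=1}^p\overline{c[\ell]}\,\mathcal{A}_{(\ell)}$. *)

(* Defs.v *)
From mathcomp Require Import all_boot all_order all_algebra.
From mathcomp Require Import all_classical all_reals all_analysis.
From mathcomp Require Import perm complex.

Set Implicit Arguments.
Unset Strict Implicit.
Unset Printing Implicit Defensive.

Import Order.TTheory GRing.Theory Num.Theory.

Local Open Scope ring_scope.

(* Conventions.
   - The complex field is R[i] with R : realType.  Its order is partial:
     x <= y means that y - x is real and nonnegative.  Hence "0 <= h" and
     "0 < h" below include the assertion that h is real.
   - All indices are 0-based.  A tubal mode has length p.+1, so that the ring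
     operations of 'I_p.+1 are those of the integers modulo p.+1. *)

Section Tubes.
Variables (R : realType) (p : nat).

Definition tube := 'rV[R[i]]_p.+1.

(* e^{it} *)
Definition cis (t : R) : R[i] := (cos t +i* sin t)%C.

Definition fft (a : tube) : tube :=
  \row_(l < p.+1) \sum_(m < p.+1) cis (- (2 * pi * (l * m)%N%:R / p.+1%:R)) * a 0 m.

Definition tconv (a b : tube) : tube :=
  \row_(l < p.+1) \sum_(m < p.+1) a 0 m * b 0 (l - m).

Definition fconj (a : tube) : tube := \row_(l < p.+1) (a 0 (- l))^*.

Definition tnonneg (a : tube) : Prop := forall l, 0 <= fft a 0 l.

End Tubes.

(* A hypermatrix of order 2k (resp. 2k+1) over n x ... x n (resp.
   n x ... x n x p.+1) is indexed by the pair of multi-indices (i_1,...,i_k)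
   and (j_1,...,j_k); in the odd case its entries are the tubes along the last
   mode. *)
Definition midx (k n : nat) := {ffun 'I_k -> 'I_n}.

Definition hypermx (T : Type) (k n : nat) := midx k n -> midx k n -> T.

Definition permidx k n (i : midx k n) (s : 'S_k) : midx k n :=
  [ffun r => i (s r)].

Section Classical.
Variables (R : realType) (k n : nat).
Implicit Types (B : hypermx R[i] k n) (z : 'rV[R[i]]_n).

Definition enorm z : R[i] := sqrtC (\sum_i `|z 0 i| ^+ 2).

Definition conj_partially_symmetric B : Prop :=
  forall (i j : midx k n) (s t : 'S_k),
    (B (permidx j s) (permidx i t))^* = B i j.

Definition hform B z : R[i] :=
  \sum_(i : midx k n) \sum_(j : midx k n)
    B i j * (\prod_r (z 0 (i r))^*) * (\prod_r z 0 (j r)).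

Definition herm_posdef B : Prop := forall z, z != 0 -> 0 < hform B z.

Definition herm_possemidef B : Prop := forall z, z != 0 -> 0 <= hform B z.

End Classical.

Section Tubal.
Variables (R : realType) (k n p : nat).
Implicit Types (A : hypermx (tube R p) k n) (Z : 'M[R[i]]_(n, p.+1)).

Definition slice A (l : 'I_p.+1) : hypermx R[i] k n := fun i j => A i j 0 l.

Definition hat A : hypermx (tube R p) k n := fun i j => fft (A i j).

Definition tconj_partially_symmetric A : Prop :=
  forall l, conj_partially_symmetric (slice (hat A) l).

(* Elements of T_p^n are n x p.+1 matrices, with the tubes as rows. *)
Definition thform A Z : tube R p :=
  \sum_(i : midx k n) \sum_(j : midx k n)
    foldl (@tconv R p) (A i j)
      ([seq fconj (row (i r) Z) | r <- enum 'I_k] ++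
       [seq row (j r) Z | r <- enum 'I_k]).

Definition therm_posdef A : Prop :=
  tconj_partially_symmetric A /\
  forall Z, Z != 0 -> tnonneg (thform A Z) /\ thform A Z != 0.

Definition therm_possemidef A : Prop :=
  tconj_partially_symmetric A /\ forall Z, Z != 0 -> tnonneg (thform A Z).

Definition tcontraction (c : tube R p) A : hypermx R[i] k n :=
  fun i j => \sum_l (c 0 l)^* * slice A l i j.

End Tubal.

Section Minimum.
Variables (R : realType) (k n p : nat).
Local Open Scope classical_set_scope.

Definition is_minimum (S : set R[i]) (m : R[i]) : Prop := S m /\ lbound S m.

(* The minimum of S if it has one, and 0 otherwise. *)
Definition minimum (S : set R[i]) : R[i] := xget 0 [set m | is_minimum S m].

Definition sphere_values (B : hypermx R[i] k n) : set R[i] :=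
  [set hform B z | z in [set z | enorm z = 1]].

Definition alpha (A : hypermx (tube R p) k n) (l : 'I_p.+1) : R[i] :=
  minimum (sphere_values (slice (hat A) l)).

Definition gamma (c : tube R p) (A : hypermx (tube R p) k n) : R[i] :=
  (p.+1%:R)^-1 * \sum_l fft c 0 l * alpha A l.

End Minimum.

(* Main.v *)
(** The Fourier transform along the tubal mode turns circular convolution into
    the slicewise product and Fourier conjugation into complex conjugation, so
    slice [l] of the transform of [h_A(Z)] is the classical form of slice [l] of
    [hat A] at slice [l] of [hat Z].  Choosing [Z] supported on a single Fourier
    slice shows that (semi)definiteness of [A] passes to every slice of
    [hat A], and compactness of the sphere then gives the sign of the minima
    [alpha_l].  By Parseval, the form of the contraction is
    [1/p sum_l conj (hat c_l) h_(hat A_l)], and each [h_(hat A_l)(z)] is at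
    least [alpha_l |z|^(2k)] by homogeneity. *)

Require Import Defs.
From mathcomp Require Import all_boot all_order all_algebra.
From mathcomp Require Import all_classical all_reals all_analysis.
From mathcomp Require Import perm complex.
From mathcomp Require Import ring lra.

Import Order.TTheory GRing.Theory Num.Theory.
Import numFieldNormedType.Exports.

Local Open Scope ring_scope.

(** * Characters of the cyclic group and the discrete Fourier transform of tubes *)

Section Characters.
Variable R : realType.

Lemma cisD (s t : R) : cis (s + t) = cis s * cis t.
Proof. by rewrite /cis cosD sinD; simpc; rewrite [cos s * sin t + _]addrC. Qed.

Lemma cis0 : cis (0 : R) = 1.
Proof. by rewrite /cis cos0 sin0. Qed.

Lemma cisMn (t : R) n : cis (t *+ n) = cis t ^+ n.
Proof.
elim: n => [|n IHn]; first by rewrite mulr0n expr0 cis0.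
by rewrite mulrS exprS cisD IHn.
Qed.

Lemma cisN_conj (t : R) : cis (- t) = (cis t)^*.
Proof. by rewrite /cis cosN sinN. Qed.

(** By the half-angle formula, [cos t = 1] would force [sin (t / 2) = 0], although [t / 2] lies
    strictly between 0 and [pi]. *)
Lemma cis_neq1 (t : R) : 0 < t < 2 * pi -> cis t != 1.
Proof.
move=> /andP[t0 tpi]; apply/eqP => -[ct _].
have : 0 < sin (t / 2) by apply: sin_gt0_pi; apply/andP; split; lra.
have : cos ((t / 2) *+ 2) = 1 by rewrite -[_ *+ 2]mulr_natr divfK ?pnatr_eq0.
rewrite cos_mulr2n cos2sin2 -[_ *+ 2]mulr_natl => sint.
have /eqP : sin (t / 2) ^+ 2 = 0 by lra.
by rewrite sqrf_eq0 => /eqP ->; rewrite ltxx.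
Qed.

Variable p : nat.

Definition tchar (l m : 'I_p.+1) : R[i] :=
  cis (- (2 * pi * (l * m)%N%:R / p.+1%:R)).

Definition tgen : R[i] := cis (- (2 * pi / p.+1%:R)).

Lemma tcharE l m : tchar l m = tgen ^+ (l * m).
Proof. by rewrite /tchar /tgen -cisMn mulNrn -[in RHS](mulr_natr (2 * pi / _)) mulrAC. Qed.

Lemma tgenX : tgen ^+ p.+1 = 1.
Proof.
rewrite -cisMn mulNrn -[_ *+ _]mulr_natr divfK ?pnatr_eq0// cisN_conj.
by rewrite /cis mulr_natl cos2pi sin2pi rmorph1.
Qed.

Lemma tcharC l m : tchar l m = tchar m l.
Proof. by rewrite !tcharE mulnC. Qed.

(** Addition in ['I_p.+1] reduces modulo [p.+1]; [tgenX] makes this reduction invisible in the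
    exponent. *)
Lemma tcharDr l m m' : tchar l (m + m') = tchar l m * tchar l m'.
Proof.
rewrite !tcharE -exprD -mulnDr !(mulnC l) !exprM.
by congr (_ ^+ _); rewrite /= expr_mod ?tgenX.
Qed.

Lemma tchar0r l : tchar l 0 = 1.
Proof. by rewrite tcharE muln0 expr0. Qed.

Lemma tcharNr l m : tchar l (- m) = (tchar l m)^*.
Proof.
have tJ : tchar l m * (tchar l m)^* = 1.
  by rewrite -cisN_conj -cisD subrr cis0.
have /mulfI : tchar l m != 0.
  by apply: contra_eq_neq tJ => ->; rewrite mul0r eq_sym oner_eq0.
by apply; rewrite tJ -tcharDr subrr tchar0r.
Qed.

(** For [d != 0] this is a geometric sum whose ratio is a [p.+1]-th root of unity different from
    1. *)
Lemma sum_tchar d : \sum_m tchar d m = if d == 0 then p.+1%:R else 0.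
Proof.
case: eqVneq => [->|d0].
  by under eq_bigr do rewrite tcharC tchar0r; rewrite sumr_const card_ord.
under eq_bigr do rewrite tcharE exprM.
have := subrX1 (tgen ^+ d) p.+1.
rewrite exprAC tgenX expr1n subrr => /esym/eqP.
rewrite mulf_eq0 subr_eq0 => /orP[|/eqP//].
(* The angle of [tgen ^+ d] is negative. Conjugation replaces it by its opposite, which lies in the
   range of [cis_neq1] because [0 < d < p.+1]. *)
rewrite -cisMn mulNrn cisN_conj -[X in _ == X]conjC1.
rewrite (inj_eq (can_inj (@conjCK _))).
have d_gt0 : (0 < d)%N.
  by rewrite lt0n; apply: contra_neq d0 => d0; apply/val_inj.
have pi0 := pi_gt0 R.
have /negPf -> // : cis (2 * pi / p.+1%:R *+ d : R) != 1.
apply: cis_neq1; rewrite -(mulr_natr (2 * pi / _)) -mulrA.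
rewrite !mulr_gt0 ?invr_gt0 ?ltr0n//=.
by rewrite gtr_pMr ?mulr_gt0// mulrC ltr_pdivrMr ?ltr0n// mul1r ltr_nat.
Qed.

Lemma tchar_orth l l' :
  \sum_m tchar l m * (tchar l' m)^* = if l == l' then p.+1%:R else 0.
Proof.
rewrite -subr_eq0 -sum_tchar; apply: eq_bigr => m _.
by rewrite (tcharC (l - l')) tcharDr tcharNr !(tcharC m).
Qed.

Lemma fftE (a : tube R p) l : fft a 0 l = \sum_m tchar l m * a 0 m.
Proof. by rewrite mxE. Qed.

Lemma fft0 l : fft (0 : tube R p) 0 l = 0.
Proof. by rewrite fftE big1 // => m _; rewrite mxE mulr0. Qed.

Lemma fftD (a b : tube R p) l : fft (a + b) 0 l = fft a 0 l + fft b 0 l.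
Proof.
by rewrite !fftE -big_split; apply: eq_bigr => m _; rewrite mxE mulrDr.
Qed.

Lemma fft_sum (I : finType) (F : I -> tube R p) l :
  fft (\sum_i F i) 0 l = \sum_i fft (F i) 0 l.
Proof.
by apply: (big_morph (fun a => fft a 0 l)) => [a b|]; rewrite ?fftD ?fft0.
Qed.

Lemma fft_tconv (a b : tube R p) l :
  fft (tconv a b) 0 l = fft a 0 l * fft b 0 l.
Proof.
rewrite !fftE mulr_suml.
under eq_bigr do rewrite mxE mulr_sumr.
rewrite exchange_big; apply: eq_bigr => m _ /=.
(* Shifting the output index by [m] turns [l - m] into a free index, so the double sum factors. *)
rewrite mulr_sumr (reindex_inj (addrI m)); apply: eq_bigr => m' _ /=.
by rewrite addrAC subrr add0r tcharDr mulrACA.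
Qed.

Lemma fft_foldl_tconv (s : seq (tube R p)) a l :
  fft (foldl (@tconv R p) a s) 0 l = fft a 0 l * \prod_(b <- s) fft b 0 l.
Proof.
elim: s a => [|b s IHs] a; first by rewrite big_nil mulr1.
by rewrite /= IHs fft_tconv big_cons mulrA.
Qed.

Lemma fft_fconj (a : tube R p) l : fft (fconj a) 0 l = (fft a 0 l)^*.
Proof.
rewrite !fftE rmorph_sum (reindex_inj (@oppr_inj _)); apply: eq_bigr => m _ /=.
by rewrite mxE opprK tcharNr rmorphM.
Qed.

Definition ifft (b : tube R p) : tube R p :=
  \row_m (p.+1%:R^-1 * \sum_l (tchar l m)^* * b 0 l).

Lemma ifftK : cancel ifft (@fft R p).
Proof.
move=> b; apply/rowP => l; rewrite fftE.
under eq_bigr do rewrite mxE mulrCA mulr_sumr.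
rewrite -mulr_sumr exchange_big /= (bigD1 l) //=.
rewrite [X in _ + X]big1 ?addr0 => [|l' ll'].
  under eq_bigr do rewrite mulrA.
  by rewrite -mulr_suml tchar_orth eqxx mulKf // pnatr_eq0.
under eq_bigr do rewrite mulrA.
by rewrite -mulr_suml tchar_orth eq_sym (negPf ll') mul0r.
Qed.

(** Expanding both transforms, orthogonality of characters leaves only the diagonal terms
    [m = m']. *)
Lemma parseval (a b : tube R p) :
  \sum_m (a 0 m)^* * b 0 m
    = p.+1%:R^-1 * \sum_l (fft a 0 l)^* * fft b 0 l.
Proof.
under [in RHS]eq_bigr do rewrite !fftE rmorph_sum mulr_suml.
rewrite exchange_big /=.
have mE m : \sum_l (tchar l m * a 0 m)^* * (\sum_m' tchar l m' * b 0 m')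
    = p.+1%:R * ((a 0 m)^* * b 0 m).
  under eq_bigr do rewrite mulr_sumr.
  have swap l m' : (tchar l m * a 0 m)^* * (tchar l m' * b 0 m')
      = (tchar m' l * (tchar m l)^*) * ((a 0 m)^* * b 0 m').
    by rewrite rmorphM mulrACA [_^* * tchar _ _]mulrC !(tcharC l).
  rewrite exchange_big (bigD1 m) //= [X in _ + X]big1 ?addr0 => [|m' mm'].
    by under eq_bigr do rewrite swap; rewrite -mulr_suml tchar_orth eqxx.
  under eq_bigr do rewrite swap.
  by rewrite -mulr_suml tchar_orth (negPf mm') mul0r.
by under [in RHS]eq_bigr do rewrite mE; rewrite -mulr_sumr mulKf // pnatr_eq0.
Qed.

(** Parseval with [b = a] makes the sum of the squared moduli of the entries vanish. *)
Lemma fft_eq0 (a : tube R p) : (forall l, fft a 0 l = 0) -> a = 0.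
Proof.
move=> fa0; have := parseval a a; rewrite [in RHS]big1 ?mulr0 => [a0|l _].
  apply/rowP => m; rewrite mxE; apply/eqP; rewrite -normr_eq0 -sqrf_eq0 normCK.
  move/eqP: a0; rewrite psumr_eq0 => [/allP /(_ m (mem_index_enum m))|i _].
    by rewrite mulrC.
  by rewrite mulrC mul_conjC_ge0.
by rewrite fa0 mulr0.
Qed.

End Characters.

(** * Homogeneity of classical forms and the Euclidean norm *)

Section Forms.
Variables (R : realType) (k n : nat).
Implicit Types (B : hypermx R[i] k n) (z : 'rV[R[i]]_n).

(** Each monomial has [k] conjugated and [k] plain variables, so the scalar contributes
    [(a^* * a) ^+ k]. *)
Lemma hformZ B (a : R[i]) z :
  hform B (a *: z) = `|a| ^+ (2 * k) * hform B z.
Proof.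
rewrite /hform mulr_sumr; apply: eq_bigr => i _.
rewrite mulr_sumr; apply: eq_bigr => j _.
under [X in _ * X * _]eq_bigr do rewrite mxE rmorphM.
under [X in _ * X = _]eq_bigr do rewrite mxE.
rewrite !big_split !prodr_const card_ord /= exprM normCK exprMn.
by ring.
Qed.

Lemma hform0 B : (0 < k)%N -> hform B 0 = 0.
Proof.
move=> k0; have := hformZ B 0 0.
by rewrite scale0r normr0 expr0n muln_eq0 /= eqn0Ngt k0 mul0r.
Qed.

Lemma enorm_ge0 z : 0 <= enorm z.
Proof. by rewrite sqrtC_ge0 sumr_ge0 // => i _; rewrite exprn_ge0. Qed.

Lemma enorm_sqr z : enorm z ^+ 2 = \sum_i `|z 0 i| ^+ 2.
Proof. exact: sqrtCK. Qed.

Lemma enorm_eq0 z : (enorm z == 0) = (z == 0).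
Proof.
rewrite sqrtC_eq0 psumr_eq0 => [|i _]; last by rewrite exprn_ge0.
apply/allP/eqP => [z0|-> i _]; last by rewrite /= mxE normr0 expr0n.
apply/rowP => i; rewrite mxE; apply/eqP.
by rewrite -normr_eq0 -sqrf_eq0; exact: (z0 i (mem_index_enum i)).
Qed.

Lemma enorm_gt0 z : (0 < enorm z) = (z != 0).
Proof. by rewrite lt0r enorm_ge0 andbT enorm_eq0. Qed.

Lemma enormZ (a : R[i]) z : enorm (a *: z) = `|a| * enorm z.
Proof.
apply/eqP; rewrite -(@eqrXn2 _ 2) ?mulr_ge0 ?enorm_ge0 //; apply/eqP.
rewrite exprMn !enorm_sqr mulr_sumr; apply: eq_bigr => i _.
by rewrite mxE normrM exprMn.
Qed.

(** Homogeneity reduces a nonzero [z] to the unit vector [(enorm z)^-1 *: z]; at [z = 0] both sides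
    vanish because [0 < k]. *)
Lemma hform_ge_sphere B (m : R[i]) z : (0 < k)%N ->
  lbound (sphere_values B) m -> m * enorm z ^+ (2 * k) <= hform B z.
Proof.
move=> k0 mB; have [->|z0] := eqVneq z 0.
  rewrite hform0 // (eqP (_ : enorm 0 == 0)) ?enorm_eq0 //.
  by rewrite expr0n muln_eq0 /= eqn0Ngt k0 mulr0.
have nz : enorm z != 0 by rewrite enorm_eq0.
have -> : hform B z = hform B ((enorm z)^-1 *: z) * enorm z ^+ (2 * k).
  rewrite hformZ normfV ger0_norm ?enorm_ge0 // exprVn mulrC mulrA.
  by rewrite divff ?mul1r // expf_neq0.
apply: ler_wpM2r; first by rewrite exprn_ge0 ?enorm_ge0.
apply: mB; exists ((enorm z)^-1 *: z) => //=.
by rewrite enormZ normfV ger0_norm ?enorm_ge0 // mulVf.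
Qed.

End Forms.

(** * Continuity of complex-valued functions, up to classical forms *)

Section ComplexContinuity.
Variables (R : realType) (T : topologicalType).
Implicit Types f g : T -> R[i].

(* Continuity is phrased with real coordinates because the Heine-Borel theorem
   of the library is for real vectors. *)
Definition ccontinuous f :=
  continuous (fun x => complex.Re (f x)) /\
  continuous (fun x => complex.Im (f x)).

Lemma ccontinuous_cst (a : R[i]) : ccontinuous (fun=> a).
Proof. by split; exact: cst_continuous. Qed.

Lemma ccontinuousD f g :
  ccontinuous f -> ccontinuous g -> ccontinuous (fun x => f x + g x).
Proof.
move=> [fr fi] [gr gi]; split=> x.
- have -> : (fun x => complex.Re (f x + g x))
    = (fun x => complex.Re (f x) + complex.Re (g x)).
    by apply/funext => y; case: (f y) (g y) => a b [].
  by apply: cvgD; [exact: fr|exact: gr].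
- have -> : (fun x => complex.Im (f x + g x))
    = (fun x => complex.Im (f x) + complex.Im (g x)).
    by apply/funext => y; case: (f y) (g y) => a b [].
  by apply: cvgD; [exact: fi|exact: gi].
Qed.

Lemma ccontinuousM f g :
  ccontinuous f -> ccontinuous g -> ccontinuous (fun x => f x * g x).
Proof.
move=> [fr fi] [gr gi]; split=> x.
- have -> : (fun x => complex.Re (f x * g x))
    = (fun x => complex.Re (f x) * complex.Re (g x)
                - complex.Im (f x) * complex.Im (g x)).
    by apply/funext => y; case: (f y) (g y) => a b [].
  by apply: cvgB; apply: cvgM; [exact: fr|exact: gr|exact: fi|exact: gi].
- have -> : (fun x => complex.Im (f x * g x))
    = (fun x => complex.Re (f x) * complex.Im (g x)
                + complex.Im (f x) * complex.Re (g x)).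
    by apply/funext => y; case: (f y) (g y) => a b [].
  by apply: cvgD; apply: cvgM; [exact: fr|exact: gi|exact: fi|exact: gr].
Qed.

Lemma ccontinuous_conj f : ccontinuous f -> ccontinuous (fun x => (f x)^*).
Proof.
move=> [fr fi]; split=> x.
- have -> : (fun x => complex.Re (f x)^*) = (fun x => complex.Re (f x)).
    by apply/funext => y; case: (f y).
  exact: fr.
- have -> : (fun x => complex.Im (f x)^*) = (fun x => - complex.Im (f x)).
    by apply/funext => y; case: (f y).
  by apply: cvgN; exact: fi.
Qed.

Lemma ccontinuous_sum (I : finType) (F : I -> T -> R[i]) :
  (forall i, ccontinuous (F i)) -> ccontinuous (fun x => \sum_i F i x).
Proof.
(* Seen as a sum in the ring of functions, the expression is open to induction on big operators. *)
move=> cF; rewrite (_ : (fun x => _) = \sum_i F i); last first.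
  by apply/funext => x; rewrite fct_sumE.
apply: (big_ind ccontinuous) => [|f g|i _]; last exact: cF.
- exact: ccontinuous_cst.
- exact: ccontinuousD.
Qed.

Lemma ccontinuous_prod (I : finType) (F : I -> T -> R[i]) :
  (forall i, ccontinuous (F i)) -> ccontinuous (fun x => \prod_i F i x).
Proof.
move=> cF; rewrite (_ : (fun x => _) = \prod_i F i); last first.
  by apply/funext => x; rewrite fct_prodE.
apply: (big_ind ccontinuous) => [|f g|i _]; last exact: cF.
- exact: ccontinuous_cst.
- exact: ccontinuousM.
Qed.

Lemma hform_ccontinuous k n (B : hypermx R[i] k n) (F : T -> 'rV[R[i]]_n) :
  (forall i, ccontinuous (fun x => F x 0 i)) ->
  ccontinuous (fun x => hform B (F x)).
Proof.
move=> cF; apply: ccontinuous_sum => i; apply: ccontinuous_sum => j.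
apply: ccontinuousM; [apply: ccontinuousM|]; first exact: ccontinuous_cst.
  by apply: ccontinuous_prod => r; exact: ccontinuous_conj.
by apply: ccontinuous_prod => r; exact: cF.
Qed.

End ComplexContinuity.
Arguments ccontinuous {R T} f.

(** * Existence of the minimum of a real-valued form on the unit sphere *)

Section SphereMinimum.
Variables (R : realType) (n : nat).
Local Open Scope classical_set_scope.

(** Real parts fill the first half of the coordinates, imaginary parts the second. The successor
    dimension keeps the unit sphere nonempty. *)
Definition complexify (x : 'rV[R]_(n.+1 + n.+1)) : 'rV[R[i]]_n.+1 :=
  \row_i (x 0 (lshift n.+1 i) +i* x 0 (rshift n.+1 i))%C.

Definition realify (z : 'rV[R[i]]_n.+1) : 'rV[R]_(n.+1 + n.+1) :=
  row_mx (\row_i complex.Re (z 0 i)) (\row_i complex.Im (z 0 i)).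

Lemma realifyK : cancel realify complexify.
Proof.
move=> z; apply/rowP => i; rewrite mxE row_mxEl row_mxEr !mxE.
by case: (z 0 i).
Qed.

Lemma enorm_complexify x : enorm (complexify x) ^+ 2 = (\sum_i x 0 i ^+ 2)%:C%C.
Proof.
rewrite enorm_sqr big_split_ord /= -big_split rmorph_sum; apply: eq_bigr => i _.
by rewrite -add_Re2_Im2 mxE.
Qed.

Lemma complexify_ccontinuous i : ccontinuous (fun x => complexify x 0 i).
Proof.
split.
- under eq_fun do rewrite mxE; exact: coord_continuous.
- under eq_fun do rewrite mxE; exact: coord_continuous.
Qed.

Let sphere : set 'rV[R]_(n.+1 + n.+1) := [set x | \sum_i x 0 i ^+ 2 = 1].

Lemma compact_sphere : compact sphere.
Proof.
apply: bounded_closed_compact.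
- exists 1; split=> // M M1 x /= xS.
  (* The norm on row vectors is the sup norm, attained at some coordinate, and the square of that
     coordinate is at most the whole sum, which is 1. *)
  apply: le_trans (ltW M1); rewrite -[leLHS]/(mx_norm x).
  have [->|/mx_norm_neq0 [[i j] /= ->]] := eqVneq (mx_norm x) 0 => //.
  rewrite -(@expr_le1 _ 2) // real_normK ?num_real // ord1 -xS.
  by rewrite (bigD1 j) //= lerDl sumr_ge0 // => l _; exact: sqr_ge0.
- have sqr_cont : continuous (fun x : 'rV[R]_(n.+1 + n.+1) => \sum_i x 0 i ^+ 2).
    apply: continuous_big => [|i _ x]; first exact: add_continuous.
    have cx := @coord_continuous R _ _ 0 i x.
    exact: (cvgM cx cx).
  exact: ((continuous_closedP _).1 sqr_cont _ (@closed_eq R 1)).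
Qed.

(** The form being real, it equals its real part, a continuous function of the real coordinates,
    which attains its minimum on the compact sphere. *)
Lemma sphere_minimumS k (B : hypermx R[i] k n.+1) :
  (forall z, hform B z \is Num.real) ->
  exists m, is_minimum (sphere_values B) m.
Proof.
move=> Breal.
have sphereP x : sphere x <-> enorm (complexify x) = 1.
  have sqr1 : enorm (complexify x) = 1 <-> enorm (complexify x) ^+ 2 = 1.
    split=> [->|/eqP]; first by rewrite expr1n.
    by rewrite sqrp_eq1 ?enorm_ge0 // => /eqP.
  rewrite sqr1 enorm_complexify; split=> [->//|xS].
  by apply: (@complexI R); rewrite xS.
have s0 : sphere !=set0.
  pose z : 'rV[R[i]]_n.+1 := delta_mx 0 0.
  exists (realify z); apply/sphereP; rewrite realifyK /enorm.
  rewrite (bigD1 0) //= mxE eqxx normr1 expr1n big1 ?addr0 ?sqrtC1 // => i i0.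
  by rewrite mxE (negPf i0) andbF normr0 expr0n.
have [fc _] := hform_ccontinuous _ _ _ _ B _ complexify_ccontinuous.
have [x xS xmin] := compact_EVT_min s0 compact_sphere
  (continuous_subspaceT fc).
exists (hform B (complexify x)); split.
  by exists (complexify x) => //=; apply/sphereP; rewrite inE in xS.
move=> _ [z /= zS <-].
rewrite -[z]realifyK -(RRe_real (Breal _)) -[leRHS](RRe_real (Breal _)) lecR.
by apply: xmin; rewrite inE; apply/sphereP; rewrite realifyK.
Qed.

End SphereMinimum.

Lemma sphere_minimum (R : realType) k n (B : hypermx R[i] k n) :
  (0 < n)%N -> (forall z, hform B z \is Num.real) ->
  exists m, is_minimum (sphere_values B) m.
Proof. by case: n B => // n B _; exact: sphere_minimumS. Qed.

(** * Passage between tubal forms, their Fourier slices and contractions *)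

Section TubalForms.
Variables (R : realType) (k n p : nat).
Implicit Types (A : hypermx (tube R p) k n) (c : tube R p) (z : 'rV[R[i]]_n).

Lemma fft_thform A (Z : 'M[R[i]]_(n, p.+1)) l :
  fft (thform A Z) 0 l
    = hform (slice (hat A) l) (\row_i fft (row i Z) 0 l).
Proof.
rewrite fft_sum; apply: eq_bigr => i _.
rewrite fft_sum; apply: eq_bigr => j _.
rewrite fft_foldl_tconv big_cat !big_map -!big_enum /= mulrA.
by congr (_ * _ * _); apply: eq_bigr => r _; rewrite mxE ?fft_fconj.
Qed.

(** The test vector concentrated on one Fourier slice: its transform is [z] on slice [l] and zero on
    the others. *)
Definition slice_lift (l : 'I_p.+1) z : 'M[R[i]]_(n, p.+1) :=
  \matrix_i ifft R p (z 0 i *: delta_mx 0 l).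

Lemma fft_slice_lift l z l' :
  \row_i fft (row i (slice_lift l z)) 0 l' = if l' == l then z else 0.
Proof.
apply/rowP => i; rewrite mxE rowK ifftK !mxE eqxx /=.
by case: ifP => _; rewrite ?mulr1 ?mulr0 ?mxE.
Qed.

Lemma slice_lift_neq0 l z : z != 0 -> slice_lift l z != 0.
Proof.
apply: contra_neq => Z0; have := fft_slice_lift l z l; rewrite eqxx Z0 => <-.
by apply/rowP => i; rewrite [LHS]mxE [RHS]mxE raddf0 fft0.
Qed.

Lemma slice_form_ge0 A l z : (0 < k)%N -> therm_possemidef A ->
  0 <= hform (slice (hat A) l) z.
Proof.
move=> k0 [_ Apos]; have [->|z0] := eqVneq z 0; first by rewrite hform0.
have := Apos _ (slice_lift_neq0 l z z0) l.
by rewrite fft_thform fft_slice_lift eqxx.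
Qed.

(** Were the slice form zero at [z], every Fourier coefficient of [thform A (slice_lift l z)] would
    vanish, the other slices being evaluated at 0; the tube itself would then be zero. *)
Lemma slice_form_gt0 A l z : (0 < k)%N -> therm_posdef A ->
  z != 0 -> 0 < hform (slice (hat A) l) z.
Proof.
move=> k0 [_ Apos] z0; have [Zpos] := Apos _ (slice_lift_neq0 l z z0).
have := Zpos l; rewrite fft_thform fft_slice_lift eqxx => h_ge0.
apply: contra_neqT; rewrite lt0r h_ge0 andbT negbK => /eqP h0.
apply: fft_eq0 => l'; rewrite fft_thform fft_slice_lift.
by case: eqVneq => [->//|_]; rewrite hform0.
Qed.

(** Semidefiniteness makes each slice form real, so a minimum exists and the default value 0 in
    [minimum] is never taken by lack of one. *)
Lemma alpha_minimum A l : (0 < k)%N -> (0 < n)%N -> therm_possemidef A ->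
  is_minimum (sphere_values (slice (hat A) l)) (alpha A l).
Proof.
move=> k0 n0 Apos.
have [|m mmin] := sphere_minimum _ _ _ (slice (hat A) l) n0.
  by move=> z; apply: ger0_real; exact: slice_form_ge0.
exact: (xgetPex 0 (ex_intro _ m mmin)).
Qed.

(** Parseval, applied to [c] and each tube [A i j], gives the entries of the contraction; the rest
    is exchange of sums. *)
Lemma hform_tcontraction A c z :
  hform (tcontraction c A) z
    = p.+1%:R^-1 * \sum_l (fft c 0 l)^* * hform (slice (hat A) l) z.
Proof.
have hatE : p.+1%:R^-1 * \sum_l (fft c 0 l)^* * hform (slice (hat A) l) z
    = \sum_i \sum_j (p.+1%:R^-1 * \sum_l (fft c 0 l)^* * fft (A i j) 0 l)
        * (\prod_r (z 0 (i r))^*) * \prod_r z 0 (j r).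
  under eq_bigr do rewrite mulr_sumr.
  rewrite exchange_big mulr_sumr; apply: eq_bigr => i _.
  under eq_bigr do rewrite mulr_sumr.
  rewrite exchange_big mulr_sumr; apply: eq_bigr => j _.
  by rewrite -!mulrA !mulr_suml; congr (_ * _); apply: eq_bigr => l _;
    rewrite !mulrA.
rewrite hatE; apply: eq_bigr => i _; apply: eq_bigr => j _.
by rewrite -parseval.
Qed.

Lemma hform_tcontraction_ge A c z : (0 < k)%N -> (0 < n)%N ->
  therm_possemidef A -> tnonneg c ->
  gamma c A * enorm z ^+ (2 * k) <= hform (tcontraction c A) z.
Proof.
move=> k0 n0 Apos cpos; rewrite hform_tcontraction /gamma -mulrA.
rewrite ler_wpM2l ?invr_ge0 ?ler0n // mulr_suml; apply: ler_sum => l _.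
(* Since [fft c 0 l] is nonnegative, it is its own conjugate and may multiply the slicewise
   inequality. *)
rewrite -mulrA geC0_conj //; apply: ler_wpM2l => //.
by apply: hform_ge_sphere => //; case: (alpha_minimum A l k0 n0 Apos).
Qed.

Lemma alpha_ge0 A l : (0 < k)%N -> (0 < n)%N -> therm_possemidef A ->
  0 <= alpha A l.
Proof.
move=> k0 n0 Apos; have [[z _ <-] _] := alpha_minimum A l k0 n0 Apos.
exact: slice_form_ge0.
Qed.

Lemma therm_posdefW A : therm_posdef A -> therm_possemidef A.
Proof. by case=> Asym Apos; split=> // Z /Apos[]. Qed.

(** The minimum is attained at a unit, hence nonzero, vector, so strict positivity survives. *)
Lemma alpha_gt0 A l : (0 < k)%N -> (0 < n)%N -> therm_posdef A ->
  0 < alpha A l.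
Proof.
move=> k0 n0 Apos.
have [[z /= z1 <-] _] := alpha_minimum A l k0 n0 (therm_posdefW A Apos).
by apply: slice_form_gt0; rewrite // -enorm_gt0 z1 ltr01.
Qed.

Lemma gamma_ge0 A c : (0 < k)%N -> (0 < n)%N -> therm_possemidef A ->
  tnonneg c -> 0 <= gamma c A.
Proof.
move=> k0 n0 Apos cpos; rewrite mulr_ge0 ?invr_ge0 ?ler0n //.
by apply: sumr_ge0 => l _; rewrite mulr_ge0 // alpha_ge0.
Qed.

(** If the sum of nonnegative terms vanished, each term would; as [alpha A l > 0], the whole
    transform of [c] would be zero, and so would [c]. *)
Lemma gamma_gt0 A c : (0 < k)%N -> (0 < n)%N -> therm_posdef A ->
  tnonneg c -> c != 0 -> 0 < gamma c A.
Proof.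
move=> k0 n0 Apos cpos c0.
have term_ge0 l : true -> 0 <= fft c 0 l * alpha A l.
  by move=> _; rewrite mulr_ge0 // ltW // alpha_gt0.
rewrite pmulr_rgt0 ?invr_gt0 ?ltr0n // lt0r sumr_ge0 // andbT.
apply: contra_neq c0 => sum0; apply: fft_eq0 => l.
have /(_ l isT)/eqP := psumr_eq0P term_ge0 sum0.
by rewrite mulf_eq0 (gt_eqF (alpha_gt0 A l k0 n0 Apos)) orbF => /eqP.
Qed.

End TubalForms.

Theorem proposition4p3 (R : realType) (k n p : nat)
    (hk : (0 < k)%N) (hn : (0 < n)%N)
    (A : hypermx (tube R p) k n) (hA : therm_possemidef A)
    (c : tube R p) (hc : tnonneg c) :
  (forall l : 'I_p.+1,
     is_minimum (sphere_values (slice (hat A) l)) (alpha A l)) /\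
  (forall z : 'rV[R[i]]_n,
     gamma c A * enorm z ^+ (2 * k) <= hform (tcontraction c A) z) /\
  herm_possemidef (tcontraction c A) /\
  (therm_posdef A -> c != 0 ->
     0 < gamma c A /\ herm_posdef (tcontraction c A)).
Proof.
have lower z : gamma c A * enorm z ^+ (2 * k) <= hform (tcontraction c A) z.
  exact: hform_tcontraction_ge.
(* This conjunct certifies that the numbers entering [gamma] are genuine attained minima. *)
split; first by move=> l; exact: alpha_minimum.
split=> //; split=> [z _|Apos c0].
  apply: le_trans (lower z).
  by rewrite mulr_ge0 ?gamma_ge0 ?exprn_ge0 ?enorm_ge0.
have gamma0 : 0 < gamma c A by exact: gamma_gt0.
split=> // z z0; apply: lt_le_trans (lower z).
by rewrite mulr_gt0 ?exprn_gt0 ?enorm_gt0.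
Qed.
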